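(* Suppose that the delays $\{\tau(k)\}_{k\in\mathbb{N}_0}$ are i.i.d. with probability distribution $\mathcal{P}$, where $\operatorname{Pr}(\tau(k)=i)=P_i$ for all $i\in\{0,\dots,\bar\tau\}$, with $\sum_{i=0}^{\bar\tau}P_i=1$ and $P_i\ge 0$ for all $i\in\{0,\dots,\bar\tau\}$. Suppose also that $\bar\tau\ge 1$ and $P_0<1$, and that the delay sequence $\{\tau(k)\}_{k\in\mathbb{N}_0}$ and the block sequence $\{i(k)\}_{k\in\mathbb{N}_0}$ are independent. Let $\{\mathbf{x}(k)\}$ be generated by DEGAS (described in the context). If $\operatorname{T}$ is pseudo-contractive with modulus $c\in(0,1)$ and $\mathbf{x}^\star\in\operatorname{Fix}\operatorname{T}$, then $$\mathbb{E}[\|\mathbf{x}(k)-\mathbf{x}^\star\|^2]\le\rho_{\mathcal{P}}^k\,\|\mathbf{x}(0)-\mathbf{x}^\star\|^2\qquad\text{for all }k\in\mathbb{N}_0,$$ where $\rho_{\mathcal{P}}=\alpha_{\mathcal{P}}\rho_a+(1-\alpha_{\mathcal{P}})\rho_c$ with $$\alpha_{\mathcal{P}}=\frac{1}{1-\phi(\rho_a)/\phi(\rho_c)}\in(0,1),$$ $$\rho_c=1-\frac{1-c^2}{m},\qquad \rho_a=\Big(1-\frac{1-c^2}{m}\Big)^{\frac{1}{1+\bar\tau/m}},\qquad \phi(\rho)=\rho-\rho_c-\frac{c^2}{m}\Big(\sum_{i=0}^{\bar\tau}P_i\rho^{-i}-1\Big).$$ Moreover, $\phi(\rho_a)\ge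 0$ and $\phi(\rho_c)<0$.
   Context: $\mathbb{N}$ is the set of natural numbers, $\mathbb{N}_0=\mathbb{N}\cup\{0\}$, $[m]=\{1,\dots,m\}$, $\|\cdot\|$ is the Euclidean norm, $\operatorname{T}:\mathbb{R}^d\to\mathbb{R}^d$ is an operator and $\operatorname{Fix}\operatorname{T}=\{\mathbf{x}:\mathbf{x}=\operatorname{T}(\mathbf{x})\}$ is its set of fixed points. Vectors $\mathbf{x}\in\mathbb{R}^d$ are split into $m$ blocks, $\mathbf{x}=(x_1,\dots,x_m)$, and $\operatorname{T}(\mathbf{x})=(\operatorname{T}_1(\mathbf{x}),\dots,\operatorname{T}_m(\mathbf{x}))$ is split accordingly. DEGAS (delay-agnostic asynchronous coordinate update algorithm): from an initial iterate $\mathbf{x}(0)\in\mathbb{R}^d$, for each $k\in\mathbb{N}_0$, $$x_j(k+1)=\operatorname{T}_j(\mathbf{x}(k-\tau(k)))\ \text{ if } j=i(k),\qquad x_j(k+1)=x_j(k)\ \text{ otherwise},$$ where the updated block $i(k)\in[m]$ is sampled uniformly at random and the integer $\tau(k)\in[0,k]$ is the delay at time $k$. The expectation is taken jointly over historical delays and block selections. $\operatorname{T}$ is pseudo-contractive with modulus $c\in(0,1)$ if $\operatorname{Fix}\operatorname{T}\neq\emptyset$ and, for any $\mathbf{x}^\star\in\operatorname{Fix}\operatorname{T}$ and $\mathbf{x}\in\mathbb{R}^d$, $\|\operatorname{T}(\mathbf{x})-\operatorname{T}(\mathbf{x}^\star)\|\le c\|\mathbf{x}-\mathbf{x}^\s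tar\|$.
   Formalization: The delay used at time k is min(τ(k),k), as i.i.d. delays with P_0<1 cannot satisfy τ(0)=0; and α_P∈(0,1) is weakened to 0<α_P≤1, with α_P<1 only if m>1 or P_τ̄<1, since α_P=1 when m=1 and P_τ̄=1. *)

(* Defs.v *)
From HB Require Import structures.
From mathcomp Require Import all_boot all_order all_algebra finmap.
From mathcomp Require Import all_classical all_reals all_analysis.

Set Implicit Arguments.
Unset Strict Implicit.
Unset Printing Implicit Defensive.

Import Order.TTheory GRing.Theory Num.Theory.

Local Open Scope classical_set_scope.
Local Open Scope ring_scope.

Section DiscreteRandomSequences.
Context (disp : measure_display) (Omega : measurableType disp) (R : realType).
Context (Pr : probability Omega R).

(* [V] is countable and carries the discrete sigma-algebra, so every subset of
   [V] defines an event. *)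
Definition discrete_rv (V : countType) (X : Omega -> V) : Prop :=
  forall B : set V, measurable (X @^-1` B).

Definition mutually_independent (V : countType) (X : nat -> Omega -> V) : Prop :=
  forall (J : {fset nat}) (B : nat -> set V),
    Pr (\bigcap_(k in [set` J]) X k @^-1` B k) =
    (\prod_(k <- J) Pr (X k @^-1` B k))%E.

Definition sigma_of_sequence (V : countType) (X : nat -> Omega -> V)
    : set (set Omega) :=
  <<s \bigcup_k [set X k @^-1` B | B in [set: set V]] >>.

Definition independent_sequences (V W : countType)
    (X : nat -> Omega -> V) (Y : nat -> Omega -> W) : Prop :=
  forall A B : set Omega,
    sigma_of_sequence X A -> sigma_of_sequence Y B ->
    Pr (A `&` B) = (Pr A * Pr B)%E.

End DiscreteRandomSequences.

(* The norm [`|x|] of MathComp-Analysis on matrices is the sup norm. *)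
Definition enorm (R : realType) (n : nat) (x : 'rV[R]_n) : R :=
  Num.sqrt (\sum_(j < n) x ord0 j ^+ 2).

Section Operators.
Context (R : realType) (n : nat).
Implicit Types (T : 'rV[R]_n -> 'rV[R]_n) (c : R).

Definition Fix T : set 'rV[R]_n := [set x | x = T x].

Definition pseudo_contractive T c : Prop :=
  Fix T !=set0 /\
  forall xstar x : 'rV[R]_n, Fix T xstar ->
    enorm (T x - T xstar) <= c * enorm (x - xstar).

End Operators.

(* The space is the product of [m] blocks of dimensions [q_ j], and block [j] of
   [x] is [submxrow x j]. Subtraction on [nat] is truncated: when the sampled
   delay exceeds [k], the iterate read is [x 0], i.e. the delay actually incurred
   is [minn (tau k) k], which lies in [0, k]. *)
Definition degas (R : realType) (Omega : Type) (m : nat) (q_ : 'I_m -> nat)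
    (T : 'rV[R]_(\sum_(j < m) q_ j)%N -> 'rV[R]_(\sum_(j < m) q_ j)%N)
    (tau : nat -> Omega -> nat) (i : nat -> Omega -> 'I_m)
    (x0 : 'rV[R]_(\sum_(j < m) q_ j)%N)
    (x : nat -> Omega -> 'rV[R]_(\sum_(j < m) q_ j)%N) : Prop :=
  (forall w, x 0%N w = x0) /\
  (forall (k : nat) (w : Omega) (j : 'I_m),
     submxrow (x k.+1 w) j =
     if j == i k w then submxrow (T (x (k - tau k w)%N w)) j
     else submxrow (x k w) j).

Section Rates.
Context (R : realType) (m : nat) (c : R) (taubar : nat) (P : 'I_taubar.+1 -> R).

Definition rho_c : R := 1 - (1 - c ^+ 2) / m%:R.

Definition rho_a : R :=
  (1 - (1 - c ^+ 2) / m%:R) `^ (1 / (1 + taubar%:R / m%:R)).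

Definition phi (rho : R) : R :=
  rho - rho_c - c ^+ 2 / m%:R * (\sum_(i < taubar.+1) P i * rho ^- i - 1).

Definition alpha_P : R := 1 / (1 - phi rho_a / phi rho_c).

Definition rho_P : R := alpha_P * rho_a + (1 - alpha_P) * rho_c.

End Rates.
Arguments rho_a {R} m c taubar.

(* Main.v *)
Require Import Defs.
From HB Require Import structures.
From mathcomp Require Import all_boot all_order all_algebra finmap.
From mathcomp Require Import all_classical all_reals all_analysis.
From mathcomp Require Import measurable_realfun.
From mathcomp Require Import ring lra.

Set Implicit Arguments.
Unset Strict Implicit.
Unset Printing Implicit Defensive.

Import Order.TTheory GRing.Theory Num.Theory.

Local Open Scope classical_set_scope.
Local Open Scope ring_scope.

(** Write E_k for the expectation of the squared distance from x(k) to xstar.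
    The pair (tau(k), i(k)) is independent of everything that x(0), ..., x(k)
    depend on, so conditioning on tau(k) = l and i(k) = j only multiplies
    expectations by P_l / m.  Replacing the block j of x(k) by that of
    T(x(k - l)) and summing over j turns the block norms into full norms, and
    the contraction bound gives the scalar recursion ([mean_energy_step])
      E_(k+1) <= sum_l (P_l / m) ((m - 1) E_k + c^2 E_(k-l)),
    where k - l is truncated at 0.  For 0 < rho < 1 the sequence
    rho^k E_0 dominates E_k as soon as it is a supersolution of the
    recursion, which is exactly phi(rho) >= 0 ([mean_energy_bound]).

    It remains to see that phi(rho_P) >= 0.  The function phi is concave
    ([phi_concave]), and alpha_P is the weight at which the chord of phi between
    rho_c and rho_a crosses zero ([phi_rho_P_ge0]).  The sign of phi(rho_c) is
    clear from rho_c < 1.  The sign of phi(rho_a) comes from Bernoulli's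
    inequality applied to z = rho_a^(taubar / m): since z^m = rho_a^taubar and
    rho_c = rho_a z, the quantity m phi(rho_a) is an explicit sum of nonnegative
    terms ([phi_rho_a]), one of which is m - 1 + z^m - m z.

    Conditioning is done by hand.  The delays and blocks drawn before time k take
    countably many values, so they are encoded by one natural number, and
    any quantity that depends on them is constant on each of the countably many
    fibers; independence of an event from every fiber then factors the integral
    ([integral_indep]). *)

(** * Convexity of powers and Bernoulli's inequality *)

(** A product of two nonnegative convex functions that vary in the same direction
    is convex: the induction step leaves the defect a (1 - a) (u - v) (u^n - v^n) >= 0. *)
Lemma expr_convex (R : realFieldType) (a u v : R) (n : nat) :
  0 <= a <= 1 -> 0 <= u -> 0 <= v ->
  (a * u + (1 - a) * v) ^+ n <= a * u ^+ n + (1 - a) * v ^+ n.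
Proof.
move=> /andP[a0 a1] u0 v0; elim: n => [|n IHn]; first by rewrite !expr0; lra.
have b0 : 0 <= 1 - a by rewrite subr_ge0.
have w0 : 0 <= a * u + (1 - a) * v by rewrite addr_ge0 ?mulr_ge0.
rewrite !exprS; apply: le_trans (ler_wpM2l w0 IHn) _.
have uv : 0 <= (u - v) * (u ^+ n - v ^+ n).
  case: (leP u v) => [uv|/ltW vu].
    by rewrite mulr_le0 ?subr_le0 ?lerXn2r.
  by rewrite mulr_ge0 ?subr_ge0 ?lerXn2r.
have := mulr_ge0 (mulr_ge0 a0 b0) uv.
move: (u ^+ n) (v ^+ n) => un vn H.
rewrite -subr_ge0; apply: le_trans H _; rewrite le_eqVlt; apply/orP; left.
by apply/eqP; ring.
Qed.

(** The inverse is convex, and the convex power is increasing on the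
    nonnegative axis. *)
Lemma exprV_convex (R : realFieldType) (a u v : R) (n : nat) :
  0 <= a <= 1 -> 0 < u -> 0 < v ->
  (a * u + (1 - a) * v) ^- n <= a * u ^- n + (1 - a) * v ^- n.
Proof.
move=> a01 u0 v0; have /andP[a0 a1] := a01.
have b0 : 0 <= 1 - a by rewrite subr_ge0.
have w0 : 0 < a * u + (1 - a) * v.
  case: (ltP 0 a) => [a_gt0|a_le0].
    by rewrite ltr_wpDr ?mulr_gt0 ?mulr_ge0 // ltW.
  have -> : a = 0 by lra.
  by rewrite mul0r add0r subr0 mul1r.
have u'0 : 0 <= u^-1 by rewrite invr_ge0 ltW.
have v'0 : 0 <= v^-1 by rewrite invr_ge0 ltW.
rewrite -!exprVn; apply: le_trans (expr_convex n a01 u'0 v'0).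
rewrite lerXn2r ?nnegrE ?addr_ge0 ?mulr_ge0 ?u'0 ?v'0 ?invr_ge0 ?(ltW w0) //.
rewrite -[leLHS]div1r ler_pdivrMr //.
have -> : (a * u^-1 + (1 - a) * v^-1) * (a * u + (1 - a) * v)
        = 1 + a * (1 - a) * ((u - v) ^+ 2 / (u * v)).
  by field; rewrite !gt_eqF.
by rewrite lerDl (mulr_ge0 (mulr_ge0 a0 b0)) // divr_ge0 ?sqr_ge0 ?mulr_ge0 ?ltW.
Qed.

Lemma bernoulli (R : realFieldType) (z : R) (n : nat) :
  0 <= z -> n%:R * z <= n%:R - 1 + z ^+ n.
Proof.
move=> z0; elim: n => [|n IHn]; first by rewrite expr0; lra.
have zIH := ler_wpM2l z0 IHn; rewrite exprS -addn1 natrD /=.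
have := mulr_ge0 (ler0n R n) (sqr_ge0 (z - 1)).
by move: zIH; move: (z ^+ n) (n%:R : R) => p q; nra.
Qed.

Lemma bernoulli_strict (R : realFieldType) (z : R) (n : nat) :
  (1 < n)%N -> 0 <= z -> z != 1 -> n%:R * z < n%:R - 1 + z ^+ n.
Proof.
case: n => // n n0 z0 z1.
have zIH := ler_wpM2l z0 (bernoulli n z0); rewrite exprS -addn1 natrD /=.
have : 0 < n%:R * (z - 1) ^+ 2.
  by rewrite mulr_gt0 ?ltr0n // lt_neqAle sqr_ge0 eq_sym expf_neq0 // subr_eq0.
by move: zIH; move: (z ^+ n) (n%:R : R) => p q; nra.
Qed.

Lemma powR_lt1_gt0 (R : realType) (x e : R) : 0 < x < 1 -> 0 < e -> x `^ e < 1.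
Proof.
move=> /andP[x0 x1] e0.
have := gt0_ltr_powR e0 _ _ x1; rewrite powR1; apply; rewrite nnegrE //.
exact: ltW.
Qed.

(** * The contraction factors *)

Section Rates.
Variables (R : realType) (m : nat) (c : R) (taubar : nat).
Hypotheses (m0 : (0 < m)%N) (c0 : 0 < c) (c1 : c < 1).
Variable P : 'I_taubar.+1 -> R.
Hypotheses (tau0 : (0 < taubar)%N) (P0 : forall l, 0 <= P l).
Hypotheses (P1 : \sum_(l < taubar.+1) P l = 1) (Plt1 : P ord0 < 1).
Local Notation rc := (rho_c m c).
Local Notation ra := (rho_a m c taubar).

Let m_gt0 : 0 < m%:R :> R. Proof. by rewrite ltr0n. Qed.
Let m_ge1 : 1 <= m%:R :> R. Proof. by rewrite ler1n. Qed.
Let c2_lt1 : c ^+ 2 < 1. Proof. by rewrite expr_lt1 // ltW. Qed.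

Lemma rho_c_bounds : 0 < rc < 1.
Proof.
have c2_gt0 : 0 < c ^+ 2 by rewrite exprn_gt0.
apply/andP; split; last by rewrite ltrBlDr ltrDl divr_gt0 // subr_gt0.
by rewrite subr_gt0 ltr_pdivrMr // mul1r; move: m_ge1 c2_gt0; lra.
Qed.

Lemma rho_a_bounds : 0 < ra < 1.
Proof.
have /andP[rc0 rc1] := rho_c_bounds.
rewrite /rho_a powR_gt0 //=.
have e0 : 0 < 1 / (1 + taubar%:R / m%:R) :> R.
  by rewrite divr_gt0 // ltr_pwDl // divr_ge0 // ler0n.
by apply: powR_lt1_gt0 => //; apply/andP.
Qed.

(** The witness is z = rho_a^(taubar / m); from here on only natural powers of
    rho_a and z occur. *)
Lemma rho_a_factor : exists z : R,
  [/\ 0 < z < 1, z ^+ m = ra ^+ taubar & rc = ra * z].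
Proof.
have /andP[ra0 ra1] := rho_a_bounds; have /andP[rc0 rc1] := rho_c_bounds.
have e0 : 0 < taubar%:R / m%:R :> R by rewrite divr_gt0 // ltr0n.
exists (ra `^ (taubar%:R / m%:R)); split.
- by rewrite powR_gt0 //=; apply: powR_lt1_gt0 => //; apply/andP.
- by rewrite -powR_mulrn ?powR_ge0 // -powRrM divfK ?gt_eqF // powR_mulrn // ltW.
- have := @powRD _ ra 1 (taubar%:R / m%:R).
  rewrite (gt_eqF ra0) implybT (powRr1 (ltW ra0)) => /(_ isT) <-.
  by rewrite /rho_a -powRrM divfK ?powRr1 // ltW.
Qed.

Lemma phi_scaled (r : R) : m%:R * phi m c P r =
  m%:R * r - (m%:R - 1) - c ^+ 2 * \sum_(l < taubar.+1) P l * r ^- l.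
Proof. by rewrite /phi /rho_c; field; rewrite gt_eqF. Qed.

Lemma weighted_inv_powers_le (r : R) : 0 < r < 1 ->
  \sum_(l < taubar.+1) P l * r ^- l <= r ^- taubar.
Proof.
move=> /andP[r0 r1]; rewrite -[leRHS]mul1r -P1 mulr_suml ler_sum // => l _.
rewrite ler_wpM2l // lef_pV2 ?posrE ?exprn_gt0 //.
by rewrite ler_wiXn2l ?ltW // -ltnS.
Qed.

(** Mass outside the largest delay sees at most the exponent taubar - 1, whose
    inverse power is strictly smaller. *)
Lemma weighted_inv_powers_lt (r : R) : 0 < r < 1 -> P ord_max < 1 ->
  \sum_(l < taubar.+1) P l * r ^- l < r ^- taubar.
Proof.
move=> /andP[r0 r1] Pmax.
have r1' : r ^- taubar.-1 < r ^- taubar.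
  rewrite ltf_pV2 ?posrE ?exprn_gt0 //.
  by rewrite -[in ltLHS](prednK tau0) exprS gtr_pMl // exprn_gt0.
rewrite big_ord_recr /=.
have Psum : \sum_(l < taubar) P (widen_ord (leqnSn taubar) l) = 1 - P ord_max.
  by apply: (addIr (P ord_max)); rewrite subrK -[RHS]P1 [RHS]big_ord_recr.
apply: (@le_lt_trans _ _ ((1 - P ord_max) * r ^- taubar.-1 +
                          P ord_max * r ^- taubar)).
  rewrite lerD2r -Psum mulr_suml ler_sum // => l _.
  rewrite ler_wpM2l // lef_pV2 ?posrE ?exprn_gt0 //.
  by rewrite ler_wiXn2l ?ltW // -ltnS prednK.
by move: r1'; move: (r ^- taubar) (r ^- taubar.-1) => a b; nra.
Qed.

Lemma weighted_inv_powers_gt1 (r : R) : 0 < r < 1 ->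
  1 < \sum_(l < taubar.+1) P l * r ^- l.
Proof.
move=> /andP[r0 r1].
have r1' : 1 < r^-1 by rewrite invf_gt1.
rewrite big_ord_recl /= expr0 invr1 mulr1.
have Psum : \sum_(l < taubar) P (lift ord0 l) = 1 - P ord0.
  by apply: (addrI (P ord0)); rewrite subrKC -[RHS]P1 [RHS]big_ord_recl.
apply: (@lt_le_trans _ _ (P ord0 + (1 - P ord0) * r^-1)).
  by move: r1' Plt1; move: (r^-1) (P ord0) => s p; nra.
rewrite lerD2l -Psum mulr_suml ler_sum // => l _.
rewrite ler_wpM2l // lef_pV2 ?posrE ?exprn_gt0 //.
by rewrite /bump /= add1n exprS ger_pMr // exprn_ile1 // ltW.
Qed.

Lemma phi_rho_c_lt0 : phi m c P rc < 0.
Proof.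
rewrite /phi subrr sub0r oppr_lt0 mulr_gt0 ?divr_gt0 ?exprn_gt0 // subr_gt0.
exact: weighted_inv_powers_gt1 rho_c_bounds.
Qed.

(** Substituting c^2 = m rho_a z - (m - 1) and adding and subtracting
    c^2 rho_a^(-taubar) splits the value of phi into three terms whose signs come
    from Bernoulli's inequality, from z^m <= z together with rho_a < 1, and from
    the fact that a weighted mean of the rho_a^(-l) is at most its largest
    term. *)
Lemma phi_rho_a (z : R) : ra ^+ taubar = z ^+ m -> rc = ra * z -> z != 0 ->
  m%:R * phi m c P ra =
    ((m%:R - 1 + z ^+ m - m%:R * z) + m%:R * (1 - ra) * (z - z ^+ m)) / z ^+ m
    + c ^+ 2 * (ra ^- taubar - \sum_(l < taubar.+1) P l * ra ^- l).
Proof.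
move=> -> rcE z0; have c2E : c ^+ 2 = m%:R * (ra * z) - (m%:R - 1).
  by rewrite -rcE /rho_c; field; rewrite gt_eqF.
rewrite phi_scaled; move: (\sum_(_ < _) _) => S; rewrite c2E.
by field; rewrite expf_neq0.
Qed.

Lemma phi_rho_a_ge0 : 0 <= phi m c P ra.
Proof.
have [z [/andP[z0 z1] zm rcE]] := rho_a_factor.
have ra01 := rho_a_bounds; have /andP[ra0 ra1] := ra01.
rewrite -(pmulr_rge0 _ m_gt0) (phi_rho_a (esym zm) rcE) ?gt_eqF //.
apply: addr_ge0; last by rewrite mulr_ge0 ?sqr_ge0 ?subr_ge0 ?weighted_inv_powers_le.
rewrite divr_ge0 ?exprn_ge0 ?(ltW z0) // addr_ge0 ?subr_ge0 ?bernoulli ?(ltW z0) //.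
rewrite !mulr_ge0 ?subr_ge0 ?(ltW ra1) //.
by rewrite -[leRHS]expr1 ler_wiXn2l // ltW.
Qed.

(** Equality in Bernoulli's inequality forces m = 1, and equality in the weighted
    mean forces all delays to equal taubar. *)
Lemma phi_rho_a_gt0 : (1 < m)%N \/ P ord_max < 1 -> 0 < phi m c P ra.
Proof.
have [z [/andP[z0 z1] zm rcE]] := rho_a_factor.
have ra01 := rho_a_bounds; have /andP[ra0 ra1] := ra01.
rewrite -(pmulr_rgt0 _ m_gt0) (phi_rho_a (esym zm) rcE) ?gt_eqF // => strict.
have zzm : 0 <= m%:R * (1 - ra) * (z - z ^+ m).
  rewrite !mulr_ge0 ?subr_ge0 ?(ltW ra1) //.
  by rewrite -[leRHS]expr1 ler_wiXn2l // ltW.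
case: strict => [m1|Pmax].
  apply: ltr_pwDl; last by rewrite mulr_ge0 ?sqr_ge0 ?subr_ge0 ?weighted_inv_powers_le.
  rewrite divr_gt0 ?exprn_gt0 // ltr_pwDl // subr_gt0 bernoulli_strict ?ltW //.
  by rewrite lt_eqF.
apply: ltr_wpDl; last by rewrite mulr_gt0 ?exprn_gt0 ?subr_gt0 ?weighted_inv_powers_lt.
by rewrite divr_ge0 ?exprn_ge0 ?(ltW z0) // addr_ge0 ?subr_ge0 ?bernoulli ?(ltW z0).
Qed.

Lemma alpha_PE : alpha_P m c P =
  phi m c P rc / (phi m c P rc - phi m c P ra).
Proof.
have fc := phi_rho_c_lt0; have fa := phi_rho_a_ge0; rewrite /alpha_P.
move: fc fa; move: (phi m c P rc) (phi m c P ra) => u v fc fa.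
have u0 : u != 0 by rewrite lt_eqF.
have d0 : u - v != 0 by rewrite lt_eqF //; lra.
by field; rewrite u0 d0.
Qed.

Lemma alpha_P_bounds : 0 < alpha_P m c P <= 1.
Proof.
have fc := phi_rho_c_lt0; have fa := phi_rho_a_ge0; rewrite alpha_PE.
move: fc fa; move: (phi m c P rc) (phi m c P ra) => u v fc fa.
have d0 : u - v < 0 by lra.
by rewrite nmulr_rgt0 // invr_lt0 d0 /= ler_ndivrMr // mul1r; lra.
Qed.

Lemma alpha_P_lt1 : 0 < phi m c P ra -> alpha_P m c P < 1.
Proof.
have fc := phi_rho_c_lt0; rewrite alpha_PE.
move: fc; move: (phi m c P rc) (phi m c P ra) => u v fc fa.
have d0 : u - v < 0 by lra.
by rewrite ltr_ndivrMr // mul1r; lra.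
Qed.

Lemma rho_P_bounds : 0 < rho_P m c P < 1.
Proof.
have /andP[a0 a1] := alpha_P_bounds.
have /andP[rc0 rc1] := rho_c_bounds; have /andP[ra0 ra1] := rho_a_bounds.
rewrite /rho_P; move: a0 a1 ra0 ra1 rc0 rc1.
move: (alpha_P _ _ _) (rho_a _ _ _) (rho_c _ _) => a u v *.
by apply/andP; split; nra.
Qed.

Lemma phi_concave (a u v : R) : 0 <= a <= 1 -> 0 < u -> 0 < v ->
  a * phi m c P u + (1 - a) * phi m c P v <= phi m c P (a * u + (1 - a) * v).
Proof.
move=> a01 u0 v0.
have S : \sum_(l < taubar.+1) P l * (a * u + (1 - a) * v) ^- l <=
    a * (\sum_(l < taubar.+1) P l * u ^- l) +
    (1 - a) * (\sum_(l < taubar.+1) P l * v ^- l).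
  rewrite !mulr_sumr -big_split /= ler_sum // => l _.
  rewrite [X in _ <= X](_ : _ = P l * (a * u ^- l + (1 - a) * v ^- l)); last by ring.
  by rewrite ler_wpM2l // exprV_convex.
rewrite /phi; move: (divr_ge0 (sqr_ge0 c) (ltW m_gt0)) S.
move: (_ / _) (\sum_(_ < _) _) (\sum_(_ < _) _) (\sum_(_ < _) _) => k A B C.
move=> k0 S; have := ler_wpM2l k0 S; nra.
Qed.

(** By its definition, alpha_P is the zero of the affine function
    a |-> a phi(rho_a) + (1 - a) phi(rho_c), which concavity keeps below phi. *)
Lemma phi_rho_P_ge0 : 0 <= phi m c P (rho_P m c P).
Proof.
have /andP[a0 a1] := alpha_P_bounds.
have /andP[rc0 rc1] := rho_c_bounds; have /andP[ra0 ra1] := rho_a_bounds.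
have a01 : 0 <= alpha_P m c P <= 1 by rewrite (ltW a0).
apply: le_trans (phi_concave a01 ra0 rc0).
have fc := phi_rho_c_lt0; have fa := phi_rho_a_ge0; rewrite alpha_PE.
move: fc fa; move: (phi m c P rc) (phi m c P ra) => u v fc fa.
rewrite le_eqVlt; apply/orP; left; apply/eqP; field.
by rewrite lt_eqF //; lra.
Qed.

(** The inequality phi(rho_P) >= 0 with denominators cleared, in the form in which
    the induction on k consumes it. *)
Lemma rho_P_supersolution :
  (m%:R - 1) + c ^+ 2 * \sum_(l < taubar.+1) P l * rho_P m c P ^- l
    <= m%:R * rho_P m c P.
Proof.
have := mulr_ge0 (ltW m_gt0) phi_rho_P_ge0.
by rewrite phi_scaled; lra.
Qed.

End Rates.

(** * Squared norms of block vectors *)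

Lemma enorm_sqr (R : realType) n (x : 'rV[R]_n) :
  enorm x ^+ 2 = (x *m x^T) ord0 ord0.
Proof.
rewrite /enorm sqr_sqrtr ?sumr_ge0 // => [|j _]; last exact: sqr_ge0.
by rewrite mxE; apply: eq_bigr => j _; rewrite mxE expr2.
Qed.

(** The squared norm is the Gram product of x with itself, and a product of block
    matrices is a sum over the blocks. *)
Lemma enorm_blocks (R : realType) m (q_ : 'I_m -> nat)
    (x : 'rV[R]_(\sum_(j < m) q_ j)%N) :
  enorm x ^+ 2 = \sum_(j < m) enorm (submxrow x j) ^+ 2.
Proof.
rewrite enorm_sqr -[in LHS](submxrowK x) tr_mxrow mul_mxrow_mxcol summxE.
by apply: eq_bigr => j _; rewrite enorm_sqr.
Qed.

Lemma enorm_block_update (R : realType) m (q_ : 'I_m -> nat)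
    (x y z : 'rV[R]_(\sum_(j < m) q_ j)%N) (j0 : 'I_m) :
  (forall j, submxrow z j = if j == j0 then submxrow y j else submxrow x j) ->
  enorm z ^+ 2 = enorm x ^+ 2 - enorm (submxrow x j0) ^+ 2
                 + enorm (submxrow y j0) ^+ 2.
Proof.
move=> zE; rewrite (enorm_blocks z) (enorm_blocks x).
rewrite [LHS](bigD1 j0) //= [X in _ = X - _ + _](bigD1 j0) //= zE eqxx.
rewrite [X in _ = X + _]addrAC subrr add0r addrC.
by congr (_ + _); apply: eq_bigr => j /negbTE jj0; rewrite zE jj0.
Qed.

(** * Integrals over events independent of the past *)

Section Past.
Context (d : measure_display) (Omega : measurableType d) (R : realType).
Context (Pr : probability Omega R).

Lemma discrete_rv_measurable (Z : Omega -> nat) (Y : Omega -> R) :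
  discrete_rv Z -> (forall w w', Z w = Z w' -> Y w = Y w') ->
  measurable_fun [set: Omega] (fun w => (Y w)%:E).
Proof.
move=> hZ YZ; apply/measurable_EFinP => _ B _; rewrite setTI.
have -> : Y @^-1` B = Z @^-1` [set n | exists2 w, Z w = n & B (Y w)].
  by apply/seteqP; split=> w /= => [BYw|[w' /YZ <-]]; first exists w.
exact: hZ.
Qed.

(** On each fiber of Z the function Y is a constant, so on [D] intersected with
    that fiber it integrates to the constant times a product of probabilities;
    countable additivity sums the fibers. *)
Lemma integral_indep (Z : Omega -> nat) (Y : Omega -> R) (D : set Omega) :
  discrete_rv Z -> (forall w w', Z w = Z w' -> Y w = Y w') ->
  (forall w, 0 <= Y w) -> measurable D ->
  (forall w0, Pr (Z @^-1` [set Z w0] `&` D) =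
     (Pr (Z @^-1` [set Z w0]) * Pr D)%E) ->
  (\int[Pr]_(w in D) (Y w)%:E = Pr D * \int[Pr]_w (Y w)%:E)%E.
Proof.
move=> hZ YZ Y0 mD indep.
pose F n := Z @^-1` [set n].
have mF n : measurable (F n) by exact: hZ.
have tF : trivIset setT F by apply/trivIsetP => a b _ _ ab;
  apply/seteqP; split=> // w [/= Za Zb]; rewrite -Za -Zb eqxx in ab.
have cF : \bigcup_n F n = setT by apply/seteqP; split=> // w _; exists (Z w).
have mY A : measurable_fun A (fun w => (Y w)%:E).
  by apply: measurable_funTS; exact: discrete_rv_measurable hZ YZ.
have split_int A : measurable A ->
    (\int[Pr]_(w in A) (Y w)%:E =
     \sum_(0 <= n <oo) \int[Pr]_(w in F n `&` A) (Y w)%:E)%E.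
  move=> mA; rewrite -[in LHS](setTI A) -cF setI_bigcupl.
  rewrite ge0_integral_bigcup //.
  - by move=> n; exact: measurableI.
  - by move=> w _; rewrite lee_fin.
  - exact: trivIset_setIr.
have PrDE : Pr D = (fine (Pr D))%:E by rewrite fineK // fin_num_measure.
rewrite (split_int D mD) (split_int setT measurableT) PrDE -nneseriesZl; last first.
  by move=> n _; apply: integral_ge0 => w _; rewrite lee_fin.
apply: eq_eseriesr => n _; rewrite setIT -PrDE.
have [[w0 Zw0]|noZ] := pselect (exists w, Z w = n); last first.
  have -> : F n = set0 by apply/seteqP; split=> // w Zw; apply: noZ; exists w.
  by rewrite set0I !integral_set0 mule0.
have const A : measurable A -> A `<=` F n ->
    (\int[Pr]_(w in A) (Y w)%:E = (Y w0)%:E * Pr A)%E.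
  move=> mA AF; rewrite -integral_cst //; apply: eq_integral => w.
  by rewrite inE => /AF Zw; rewrite (YZ w w0) // Zw0.
rewrite (const _ (mF n)) // (const _ (measurableI _ _ (mF n) mD));
  last exact: subIsetl.
by rewrite /F -Zw0 indep [RHS]muleCA (muleC (Pr D)).
Qed.

(** The product rule over 0, ..., k and the one over 0, ..., k - 1 differ by exactly
    the factor at time k. *)
Lemma independent_of_past (V : countType) (X : nat -> Omega -> V)
    (B : nat -> set V) (A : set V) k :
  mutually_independent Pr X ->
  Pr (\bigcap_(n < k) X n @^-1` B n `&` X k @^-1` A) =
  (Pr (\bigcap_(n < k) X n @^-1` B n) * Pr (X k @^-1` A))%E.
Proof.
move=> indep; pose J := seq_fset tt (iota 0 k).
have JE : [set` J] = `I_k.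
  by apply/seteqP; split=> n /=; rewrite seq_fsetE mem_iota.
have kJ : k \notin J by rewrite seq_fsetE mem_iota /= add0n ltnn.
pose B' n := if n == k then A else B n.
have BB' n : (n < k)%N -> B' n = B n by move=> nk; rewrite /B' ltn_eqF.
have B'k : B' k = A by rewrite /B' eqxx.
rewrite -B'k.
have -> : \bigcap_(n < k) X n @^-1` B n = \bigcap_(n < k) X n @^-1` B' n.
  by apply: eq_bigcapr => n /= nk; rewrite BB'.
have -> : \bigcap_(n < k) X n @^-1` B' n `&` X k @^-1` B' k =
    \bigcap_(n in [set` (k |` J)%fset]) X n @^-1` B' n.
  by rewrite set_fsetU1 bigcap_setU1 JE setIC.
by rewrite -JE !indep big_fsetU1 //= muleC.
Qed.

(** Only the total probability of the pieces is known to be 1, so their union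
    may miss a null set; this is how the range of the delays enters, since their
    law is only prescribed on 0, ..., taubar. *)
Lemma ae_partition_integral (I : finType) (D : I -> set Omega) (Y : Omega -> R) :
  (forall p, measurable (D p)) -> trivIset setT D ->
  (\sum_p Pr (D p) = 1)%E ->
  measurable_fun [set: Omega] (fun w => (Y w)%:E) -> (forall w, 0 <= Y w) ->
  (\int[Pr]_w (Y w)%:E = \sum_p \int[Pr]_(w in D p) (Y w)%:E)%E.
Proof.
move=> mD tD D1 mY Y0; pose U := \big[setU/set0]_(p : I) D p.
have mU : measurable U by apply: bigsetU_measurable.
(* The case f = 1 yields the probability of the union. *)
have split_int f : measurable_fun [set: Omega] f -> (forall w, (0 <= f w)%E) ->
    (\int[Pr]_(w in U) f w = \sum_p \int[Pr]_(w in D p) f w)%E.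
  move=> mf f0; apply: ge0_integral_bigsetU => //.
  - exact: index_enum_uniq.
  - exact: sub_trivIset tD.
  - exact: measurable_funTS.
have PrU : Pr U = 1%E.
  rewrite -[LHS]mul1e -integral_cst // split_int //.
  by rewrite -[RHS]D1; apply: eq_bigr => p _; rewrite integral_cst // mul1e.
have mUC : measurable (~` U) by exact: measurableC.
have PrUC : Pr (~` U) = 0%E by rewrite probability_setC // PrU subee.
have mYA A : measurable_fun A (fun w => (Y w)%:E) by exact: measurable_funTS.
have Ye w : (0 <= (Y w)%:E)%E by rewrite lee_fin.
rewrite -split_int // -(setUv U) ge0_integral_setU //; last first.
  by rewrite disj_set2E setICr.
by rewrite (null_set_integral mUC) ?adde0.
Qed.

Section PastOfTwo.
Context (V W : countType) (X : nat -> Omega -> V) (Y : nat -> Omega -> W).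
Hypotheses (rvX : forall k, discrete_rv (X k)) (rvY : forall k, discrete_rv (Y k)).

(** The history before time k, encoded as a natural number so that its fibers form
    a sequence of events. *)
Definition past_code k w : nat := choice.pickle (mkseq (fun n => (X n w, Y n w)) k).

Lemma past_code_fiber k w0 : past_code k @^-1` [set past_code k w0] =
  \bigcap_(n < k) X n @^-1` [set X n w0] `&` \bigcap_(n < k) Y n @^-1` [set Y n w0].
Proof.
apply/seteqP; split=> w /=.
  move=> /(pcan_inj choice.pickleK) /eq_in_map XY.
  by split=> n /= nk; have := XY n; rewrite mem_iota add0n => /(_ nk) [].
move=> [Xw Yw]; congr choice.pickle.
apply/eq_in_map => n; rewrite mem_iota add0n => nk.
by rewrite (Xw n nk) (Yw n nk).
Qed.

Lemma discrete_past_code k : discrete_rv (past_code k).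
Proof.
move=> B; have -> : past_code k @^-1` B = \bigcup_(n in B) past_code k @^-1` [set n].
  by apply/seteqP; split=> w /= => [Bw|[n Bn ->] //]; exists (past_code k w).
apply: bigcup_measurable => n _.
have [[w0 <-]|noZ] := pselect (exists w, past_code k w = n); last first.
  rewrite (_ : _ @^-1` _ = set0); first exact: measurable0.
  by apply/seteqP; split=> // w Zw; apply: noZ; exists w.
rewrite past_code_fiber; apply: measurableI; apply: bigcap_measurableType => j _.
- exact: rvX.
- exact: rvY.
Qed.

Hypotheses (indX : mutually_independent Pr X) (indY : mutually_independent Pr Y).
Hypothesis (indXY : independent_sequences Pr X Y).

Lemma sigma_of_sequence_preimage (T : countType) (Z : nat -> Omega -> T) k A :
  sigma_of_sequence Z (Z k @^-1` A).
Proof. by apply: sub_gen_smallest; exists k => //; exists A. Qed.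

Lemma sigma_of_sequence_past (T : countType) (Z : nat -> Omega -> T)
    (B : nat -> set T) k :
  sigma_of_sequence Z (\bigcap_(n < k) Z n @^-1` B n).
Proof.
apply: (@bigcap_measurableType _ (g_sigma_algebraType
  (\bigcup_k [set Z k @^-1` B | B in [set: set T]]))) => n _.
exact: sigma_of_sequence_preimage.
Qed.

Lemma sigma_of_sequenceI (T : countType) (Z : nat -> Omega -> T) A B :
  sigma_of_sequence Z A -> sigma_of_sequence Z B -> sigma_of_sequence Z (A `&` B).
Proof.
exact: (@measurableI _ (g_sigma_algebraType
  (\bigcup_k [set Z k @^-1` B | B in [set: set T]]))).
Qed.

Lemma prob_present k A B : Pr (X k @^-1` A `&` Y k @^-1` B) =
  (Pr (X k @^-1` A) * Pr (Y k @^-1` B))%E.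
Proof. by apply: indXY; exact: sigma_of_sequence_preimage. Qed.

(** A fiber is a cylinder in X intersected with a cylinder in Y.  Regrouping the X
    events and the Y events lets independence of the two sequences split the
    probability, and independence inside each sequence splits off time k. *)
Lemma past_code_indep k w0 A B :
  Pr (past_code k @^-1` [set past_code k w0] `&` (X k @^-1` A `&` Y k @^-1` B)) =
  (Pr (past_code k @^-1` [set past_code k w0]) * Pr (X k @^-1` A `&` Y k @^-1` B))%E.
Proof.
rewrite past_code_fiber prob_present setIACA.
have sX := @sigma_of_sequence_past _ X (fun n => [set X n w0]) k.
have sY := @sigma_of_sequence_past _ Y (fun n => [set Y n w0]) k.
rewrite (indXY sX sY) indXY; last 2 first.
- by apply: sigma_of_sequenceI => //; exact: sigma_of_sequence_preimage.
- by apply: sigma_of_sequenceI => //; exact: sigma_of_sequence_preimage.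
rewrite (@independent_of_past _ X (fun n => [set X n w0])) //.
rewrite (@independent_of_past _ Y (fun n => [set Y n w0])) //.
by rewrite muleACA.
Qed.

End PastOfTwo.
End Past.

(** * The expected energy of the iterates *)

Section Degas.
Context (R : realType) (d : measure_display) (Omega : measurableType d).
Context (Pr : probability Omega R) (m : nat) (q_ : 'I_m -> nat).
Local Notation space := 'rV[R]_(\sum_(j < m) q_ j)%N.
Context (T : space -> space) (c : R) (xstar : space).
Hypotheses (m0 : (0 < m)%N) (hT : pseudo_contractive T c) (hxstar : Fix T xstar).
Context (taubar : nat) (P : 'I_taubar.+1 -> R).
Hypotheses (P0 : forall l, 0 <= P l) (P1 : \sum_(l < taubar.+1) P l = 1).
Context (tau : nat -> Omega -> nat) (i : nat -> Omega -> 'I_m).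
Hypotheses (rv_tau : forall k, discrete_rv (tau k)) (rv_i : forall k, discrete_rv (i k)).
Hypothesis tau_dist : forall (k : nat) (l : 'I_taubar.+1),
  Pr (tau k @^-1` [set (l : nat)]) = (P l)%:E.
Hypothesis i_unif : forall (k : nat) (j : 'I_m),
  Pr (i k @^-1` [set j]) = (m%:R^-1)%:E.
Hypotheses (ind_tau : mutually_independent Pr tau) (ind_i : mutually_independent Pr i).
Hypothesis ind_tau_i : independent_sequences Pr tau i.
Context (x0 : space) (x : nat -> Omega -> space).
Hypothesis hx : degas T tau i x0 x.

Let m_gt0 : 0 < m%:R :> R. Proof. by rewrite ltr0n. Qed.

(** The algorithm is deterministic once the delays and blocks are drawn. *)
Lemma degas_past k w w' : past_code tau i k w = past_code tau i k w' ->
  forall l, (l <= k)%N -> x l w = x l w'.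
Proof.
move=> past; have : (past_code tau i k @^-1` [set past_code tau i k w']) w by [].
rewrite past_code_fiber => -[tauE iE] l.
elim/ltn_ind: l => -[|l] IHl lk; first by rewrite !hx.1.
rewrite -(submxrowK (x l.+1 w)) -(submxrowK (x l.+1 w')).
apply: eq_mxrow => j; rewrite !hx.2 (tauE l lk) (iE l lk).
rewrite (IHl l) ?(ltnW lk) // (IHl (l - tau l w')%N) ?ltnS ?leq_subr //.
exact: leq_trans (leq_subr _ _) (ltnW lk).
Qed.

Let energy k w : R := enorm (x k w - xstar) ^+ 2.
Let mean_energy k : \bar R := (\int[Pr]_w (energy k w)%:E)%E.

Let energy_ge0 k w : 0 <= energy k w. Proof. exact: sqr_ge0. Qed.

Let measurable_past k (Y : Omega -> R) :
  (forall w w', past_code tau i k w = past_code tau i k w' -> Y w = Y w') ->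
  measurable_fun [set: Omega] (fun w => (Y w)%:E).
Proof. exact: discrete_rv_measurable (discrete_past_code rv_tau rv_i k). Qed.

Let measurable_energy k : measurable_fun [set: Omega] (fun w => (energy k w)%:E).
Proof.
by apply: (@measurable_past k) => w w' /degas_past xE; rewrite /energy xE.
Qed.

Let outcome k (p : 'I_taubar.+1 * 'I_m) : set Omega :=
  tau k @^-1` [set (p.1 : nat)] `&` i k @^-1` [set p.2].

Let prob_outcome k p : Pr (outcome k p) = (P p.1 / m%:R)%:E.
Proof. by rewrite /outcome (prob_present ind_tau_i) tau_dist i_unif EFinM. Qed.

Let measurable_outcome k p : measurable (outcome k p).
Proof. by apply: measurableI; [exact: rv_tau|exact: rv_i]. Qed.

Let trivIset_outcome k : trivIset setT (outcome k).
Proof.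
move=> [l j] [l' j'] _ _ [w [/= [lw jw] [l'w j'w]]].
by congr (_, _); [exact: val_inj (etrans (esym lw) l'w)|exact: etrans (esym jw) j'w].
Qed.

Let sum_prob_outcome k : (\sum_p Pr (outcome k p) = 1)%E.
Proof.
under eq_bigr do rewrite prob_outcome.
rewrite sumEFin -(pair_bigA _ (fun l (_ : 'I_m) => P l / m%:R)) /=; congr (_%:E).
rewrite -[RHS]P1; apply: eq_bigr => l _.
by rewrite sumr_const card_ord -[LHS]mulr_natr divfK ?gt_eqF.
Qed.

(** The energy at time k + 1 on the event [outcome k p], written so that it depends
   on the history before time k alone. *)
Let next_energy k (p : 'I_taubar.+1 * 'I_m) w : R :=
  energy k w - enorm (submxrow (x k w - xstar) p.2) ^+ 2
  + enorm (submxrow (T (x (k - p.1)%N w) - xstar) p.2) ^+ 2.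

Let next_energyE k p w : outcome k p w -> energy k.+1 w = next_energy k p w.
Proof.
move=> [tauw iw]; apply: enorm_block_update => j.
rewrite !submxrowB hx.2 tauw iw.
by case: ifP.
Qed.

Let next_energy_ge0 k p w : 0 <= next_energy k p w.
Proof.
rewrite addr_ge0 ?sqr_ge0 // subr_ge0 /energy (enorm_blocks (x k w - xstar)).
by rewrite [X in _ <= X](bigD1 p.2) //= lerDl sumr_ge0 // => j _; rewrite sqr_ge0.
Qed.

(** Each of the m choices of the block refreshes one block and keeps the other
   m - 1, so every block is kept m - 1 times and refreshed once. *)
Let sum_next_energy k l w : \sum_(j < m) next_energy k (l, j) w <=
  (m%:R - 1) * energy k w + c ^+ 2 * energy (k - l)%N w.
Proof.
rewrite /next_energy /= !big_split /= sumrN -!enorm_blocks.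
rewrite sumr_const card_ord -[X in X - _ + _ <= _]mulr_natl mulrBl mul1r lerD2l.
have := hT.2 xstar (x (k - l)%N w) hxstar; rewrite -{1}hxstar => le_T.
rewrite -exprMn lerXn2r ?nnegrE ?sqrtr_ge0 //.
by apply: le_trans le_T; rewrite sqrtr_ge0.
Qed.

(** The law of total expectation over the draw at time k: on each outcome the
    next energy is a function of the history, which is independent of the
    outcome. *)
Lemma mean_energy_step k : (mean_energy k.+1 <=
  \sum_(l < taubar.+1) (P l / m%:R)%:E *
    ((m%:R - 1)%:E * mean_energy k + (c ^+ 2)%:E * mean_energy (k - l)%N))%E.
Proof.
have next_past p w w' : past_code tau i k w = past_code tau i k w' ->
    next_energy k p w = next_energy k p w'.
  by move=> /degas_past xE; rewrite /next_energy /energy !xE // leq_subr.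
rewrite /mean_energy (ae_partition_integral (measurable_outcome k)) //.
rewrite (eq_bigr (fun p => (P p.1 / m%:R)%:E *
    \int[Pr]_w (next_energy k (p.1, p.2) w)%:E)%E); last first.
  move=> p _; rewrite -surjective_pairing.
  rewrite -(prob_outcome k) -(integral_indep (discrete_past_code rv_tau rv_i k)) //.
  - by apply: eq_integral => w; rewrite inE => /next_energyE ->.
  - exact: next_past.
  - by move=> w0; exact: past_code_indep.
rewrite -(pair_bigA _ (fun l j => (P l / m%:R)%:E *
    \int[Pr]_w (next_energy k (l, j) w)%:E)%E) /=.
have w_ge0 : 0 <= m%:R - 1 :> R by rewrite subr_ge0 ler1n.
apply: lee_sum => l _; rewrite -ge0_sume_distrr; last first.
  by move=> j _; apply: integral_ge0 => w _; rewrite lee_fin.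
rewrite lee_wpmul2l ?lee_fin ?divr_ge0 ?(ltW m_gt0) //.
rewrite -ge0_integral_sum //; last 2 first.
- by move=> j; apply: measurable_past => w w'; exact: next_past.
- by move=> j w _; rewrite lee_fin.
rewrite -!ge0_integralZl ?lee_fin ?sqr_ge0 //; last 2 first.
- by move=> w _; rewrite lee_fin.
- by move=> w _; rewrite lee_fin.
rewrite -ge0_integralD //; last 4 first.
- by move=> w _; rewrite -EFinM lee_fin mulr_ge0.
- exact: measurable_funeM.
- by move=> w _; rewrite -EFinM lee_fin mulr_ge0 ?sqr_ge0.
- exact: measurable_funeM.
apply: ge0_le_integral => //.
- by move=> w _; apply: sume_ge0 => j _; rewrite lee_fin.
- by apply: emeasurable_sum => j; apply: measurable_past => w w'; exact: next_past.
- by apply: emeasurable_funD; exact: measurable_funeM.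
- by move=> w _; rewrite sumEFin lee_fin; exact: sum_next_energy.
Qed.

(** Strong induction on k, since a step reads iterates as old as k - taubar. *)
Lemma mean_energy_bound (rho : R) : 0 < rho < 1 ->
  (m%:R - 1) + c ^+ 2 * \sum_(l < taubar.+1) P l * rho ^- l <= m%:R * rho ->
  forall k, (mean_energy k <= (rho ^+ k * enorm (x0 - xstar) ^+ 2)%:E)%E.
Proof.
move=> /andP[rho0 rho1] rho_super; set e0 := enorm (x0 - xstar) ^+ 2.
have e0_ge0 : 0 <= e0 by exact: sqr_ge0.
elim/ltn_ind => -[|k] IHk.
  rewrite expr0 mul1r /mean_energy (eq_integral (cst e0%:E)); last first.
    by move=> w _; rewrite /energy hx.1.
  by rewrite integral_cst // [X in (_ * X)%E]probability_setT mule1.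
have w_ge0 : 0 <= m%:R - 1 :> R by rewrite subr_ge0 ler1n.
(* Truncation of k - l at 0 is harmless because rho < 1: for l > k the true
   exponent k - l is negative, and rho^(k - l) is then at least 1. *)
have delayed (l : nat) : rho ^+ (k - l) <= rho ^+ k * rho ^- l.
  rewrite ler_pdivlMr ?exprn_gt0 // -exprD ler_wiXn2l ?(ltW rho0) ?(ltW rho1) //.
  by rewrite addnC -leq_subLR.
apply: le_trans (mean_energy_step k) _.
apply: (@le_trans _ _ (\sum_(l < taubar.+1) (P l / m%:R *
   ((m%:R - 1) * (rho ^+ k * e0) + c ^+ 2 * (rho ^+ k * rho ^- l * e0)))%:E)%E).
  apply: lee_sum => l _; rewrite [X in (_ <= X)%E]EFinM [X in (_ <= _ * X)%E]EFinD.
  rewrite lee_wpmul2l ?lee_fin ?divr_ge0 ?(ltW m_gt0) //.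
  rewrite (EFinM (_ - _)) (EFinM (_ ^+ 2)).
  apply: leeD; apply: lee_wpmul2l; rewrite ?lee_fin ?sqr_ge0 //.
    exact: IHk.
  apply: le_trans (IHk _ _) _; first by rewrite ltnS leq_subr.
  by rewrite lee_fin ler_wpM2r.
rewrite sumEFin lee_fin.
rewrite (_ : \sum_(l < _) _ = rho ^+ k * e0 / m%:R *
    ((m%:R - 1) + c ^+ 2 * \sum_(l < taubar.+1) P l * rho ^- l)); last first.
  rewrite [X in _ * (X + _)](_ : _ = \sum_(l < taubar.+1) P l * (m%:R - 1)); last first.
    by rewrite -mulr_suml P1 mul1r.
  rewrite mulr_sumr -big_split /= mulr_sumr.
  by apply: eq_bigr => l _; move: (rho ^- l) => s; field; rewrite gt_eqF.
apply: (@le_trans _ _ (rho ^+ k * e0 / m%:R * (m%:R * rho))).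
  apply: (ler_wpM2l _ rho_super).
  by rewrite divr_ge0 ?ler0n // mulr_ge0 // exprn_ge0 // ltW.
by rewrite exprS le_eqVlt; apply/orP; left; apply/eqP; field; rewrite gt_eqF.
Qed.

End Degas.

Theorem theorem2 (R : realType) (disp : measure_display)
    (Omega : measurableType disp) (Pr : probability Omega R)
    (m : nat) (hm : (0 < m)%N) (q_ : 'I_m -> nat)
    (T : 'rV[R]_(\sum_(j < m) q_ j)%N -> 'rV[R]_(\sum_(j < m) q_ j)%N)
    (c : R) (hc0 : 0 < c) (hc1 : c < 1) (hT : pseudo_contractive T c)
    (xstar : 'rV[R]_(\sum_(j < m) q_ j)%N) (hxstar : Fix T xstar)
    (taubar : nat) (htaubar : (1 <= taubar)%N)
    (P : 'I_taubar.+1 -> R) (hP0 : forall l, 0 <= P l)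
    (hP1 : \sum_(l < taubar.+1) P l = 1) (hPlt1 : P ord0 < 1)
    (tau : nat -> Omega -> nat) (htau : forall k, discrete_rv (tau k))
    (htau_dist : forall (k : nat) (l : 'I_taubar.+1),
       Pr (tau k @^-1` [set (l : nat)]) = (P l)%:E)
    (htau_indep : mutually_independent Pr tau)
    (i : nat -> Omega -> 'I_m) (hi : forall k, discrete_rv (i k))
    (hi_unif : forall (k : nat) (j : 'I_m),
       Pr (i k @^-1` [set j]) = (m%:R^-1)%:E)
    (hi_indep : mutually_independent Pr i)
    (htau_i : independent_sequences Pr tau i)
    (x0 : 'rV[R]_(\sum_(j < m) q_ j)%N)
    (x : nat -> Omega -> 'rV[R]_(\sum_(j < m) q_ j)%N)
    (hx : degas T tau i x0 x) :
  (forall k : nat,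
     ('E_Pr[(fun w => (enorm (x k w - xstar) ^+ 2)%R)] <=
      (rho_P m c P ^+ k * enorm (x0 - xstar) ^+ 2)%:E)%E) /\
  0 < alpha_P m c P /\ alpha_P m c P <= 1 /\
  ((1 < m)%N \/ P ord_max < 1 -> alpha_P m c P < 1) /\
  0 <= phi m c P (rho_a m c taubar) /\
  phi m c P (rho_c m c) < 0.
Proof.
have /andP[alpha0 alpha1] := alpha_P_bounds hm hc0 hc1 htaubar hP0 hP1 hPlt1.
split; last first.
  do !split => //.
  - move=> strict; apply: alpha_P_lt1 => //; exact: phi_rho_a_gt0.
  - exact: phi_rho_a_ge0.
  - exact: phi_rho_c_lt0.
move=> k; rewrite expectation.unlock.
apply: (mean_energy_bound hm hT hxstar hP0 hP1 htau hi htau_dist hi_unif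
  htau_indep hi_indep htau_i hx).
- exact: rho_P_bounds.
- exact: rho_P_supersolution.
Qed.
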